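(* Let $k$ be any field, $S=k[x,y,s,t]$, $F=xy(x-y)(sx-ty)=sx^3y-(t+s)x^2y^2+txy^3$, and $R=S/FS$. Let $\mathcal{S}$ be an infinite set of positive integers, and suppose that either $k$ has characteristic zero, or $k$ has prime characteristic $p$ and $\mathcal{S}$ contains infinitely many powers of $p$. Then the set $$\bigcup_{n\in\mathcal{S}}\operatorname{Ass}_R\left(\frac{R}{\langle x^n,y^n\rangle}\right)$$ is infinite.
   Context: $\langle x^n,y^n\rangle$ denotes the ideal of $R$ generated by the images of $x^n$ and $y^n$; $\operatorname{Ass}_R$ denotes the set of associated prime ideals of an $R$-module. *)

(* Defs.v *)
From Stdlib Require Lists.List.
From HB Require Import structures.
From mathcomp Require Import all_boot all_order all_algebra.
From mathcomp Require Import mpoly.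
Set Implicit Arguments. Unset Strict Implicit. Unset Printing Implicit Defensive.
Import GRing.Theory.
Local Open Scope ring_scope.

Definition is_ideal (R : comPzRingType) (I : R -> Prop) : Prop :=
  [/\ I 0, (forall a b, I a -> I b -> I (a - b)) & (forall r a, I a -> I (r * a))].

Definition is_prime_ideal (R : comPzRingType) (P : R -> Prop) : Prop :=
  [/\ is_ideal P, ~ P 1 & (forall a b, P (a * b) -> P a \/ P b)].

Definition ideal2 (R : comPzRingType) (u v : R) : R -> Prop :=
  fun a => exists c d : R, a = c * u + d * v.

(* Ass_R(R/I): primes P equal to the annihilator of some element r + I
   of the cyclic module R/I, i.e. P = {a | a * r \in I}. *)
Definition Ass_quot (R : comPzRingType) (I : R -> Prop) (P : R -> Prop) : Prop :=
  is_prime_ideal P /\ exists r : R, forall a, P a <-> I (a * r).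

Definition infinite_family (R : Type) (U : (R -> Prop) -> Prop) : Prop :=
  forall l : seq (R -> Prop), exists P, U P /\
    (forall Q, Stdlib.Lists.List.In Q l -> ~ (forall a, P a <-> Q a)).

Definition varx (k : fieldType) : {mpoly k[4]} := 'X_(inord 0).
Definition vary (k : fieldType) : {mpoly k[4]} := 'X_(inord 1).
Definition vars (k : fieldType) : {mpoly k[4]} := 'X_(inord 2).
Definition vart (k : fieldType) : {mpoly k[4]} := 'X_(inord 3).

Definition polyF (k : fieldType) : {mpoly k[4]} :=
  varx k * vary k * (varx k - vary k) * (vars k * varx k - vart k * vary k).

(* Main.v *)
Require Import Defs.
From HB Require Import structures.
From mathcomp Require Import all_boot all_order all_algebra all_field.
From mathcomp Require Import mpoly ring zify.
From Stdlib Require Import Classical.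
Import GRing.Theory.
Local Open Scope ring_scope.

(** Put [n = N + 2], [H = 1 + z + ... + z^N] and let [D] be the form of degree
    [N] in [s, t] obtained by homogenizing [H]. The multiples of [F] in degree
    [n + 1] give a tridiagonal system which shows that [D x^2 y^(n-1)] lies in
    [(x^n, y^n, F)]. When [n - 1] is nonzero in [k], [H] is separable; for an
    irreducible factor [Q] of [H] the ideal [(x, y, hom Q)] is then the
    annihilator of [s hom(H/Q) x^2 y^(n-1)]: evaluate a relation
    on the four lines in the plane where [F] vanishes, with [t/s] specialized to a
    root of [Q], and compare coefficients of degree [n + 1]. Since [deg H] is
    unbounded, no nonzero polynomial is divisible by all the [Q] that arise. *)

(** * Homogenization of polynomials in one variable *)

(** The degree [d] is a parameter, which makes the form additive in [p]. Coefficients beyond [d] are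
    dropped, hence the size bounds below. *)
Definition homogenize {A : comNzRingType} (s t : A) (d : nat) (p : {poly A}) : A :=
  \sum_(i < d.+1) p`_i * (s ^+ (d - i) * t ^+ i).

Section Homogenize.
Context {A : comNzRingType}.
Implicit Types (s t c : A) (p q : {poly A}).

Lemma homogenizeD s t d p q :
  homogenize s t d (p + q) = homogenize s t d p + homogenize s t d q.
Proof.
by rewrite /homogenize -big_split /=; apply: eq_bigr => i _; rewrite coefD mulrDl.
Qed.

Lemma homogenize0 s t d : homogenize s t d 0 = 0.
Proof. by apply: big1 => i _; rewrite coef0 mul0r. Qed.

Lemma homogenizeCM s t d c p :
  homogenize s t d (c%:P * p) = c * homogenize s t d p.
Proof.
by rewrite /homogenize mulr_sumr; apply: eq_bigr => i _; rewrite coefCM -mulrA.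
Qed.

Lemma homogenizeMX s t d p :
  homogenize s t d.+1 (p * 'X) = t * homogenize s t d p.
Proof.
rewrite /homogenize big_ord_recl coefMX mul0r add0r mulr_sumr.
apply: eq_bigr => i _; rewrite coefMX /= /bump /= add1n subSS exprS; ring.
Qed.

Lemma homogenizeXn s t d i : (i <= d)%N ->
  homogenize s t d 'X^i = s ^+ (d - i) * t ^+ i.
Proof.
elim: i d => [|i IHi] [|d] // le_id.
- by rewrite /homogenize big_ord1 coefXn mul1r.
- rewrite /homogenize big_ord_recl coefXn mul1r big1 ?addr0 // => j _.
  by rewrite coefXn mul0r.
- by rewrite exprSr homogenizeMX IHi // subSS exprS; ring.
Qed.

Lemma homogenize_widen s t d e p : (size p <= d.+1)%N ->
  homogenize s t (d + e) p = s ^+ e * homogenize s t d p.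
Proof.
move=> sp; rewrite /homogenize (big_ord_widen (d + e).+1
  (fun i => p`_i * (s ^+ (d - i) * t ^+ i))) ?ltnS ?leq_addr //.
rewrite [X in _ = _ * X]big_mkcond mulr_sumr; apply: eq_bigr => i _ /=.
case: ltnP => [le_id|lt_di]; last first.
  by rewrite nth_default ?mul0r ?mulr0 // (leq_trans sp).
rewrite -addnBAC // exprD; ring.
Qed.

Lemma homogenizeM s t d e p q : (size p <= d.+1)%N -> (size q <= e.+1)%N ->
  homogenize s t (d + e) (p * q) = homogenize s t d p * homogenize s t e q.
Proof.
move=> sp sq; elim/poly_ind: p d sp => [|p c IHp] d sp.
  by rewrite mul0r !homogenize0 mul0r.
rewrite mulrDl !homogenizeD homogenizeCM (addnC d e) (homogenize_widen s t e d q) // (addnC e d).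
have -> : homogenize s t d c%:P = c * s ^+ d.
  by rewrite -[c%:P]mulr1 homogenizeCM -(expr0 'X) homogenizeXn // subn0 mulr1.
(* For [d = 0] the size bound leaves only the constant [c]. *)
case: d sp => [|d]; rewrite size_MXaddC => sp.
  have -> : p = 0 by case: eqP sp => //= _; rewrite ltnS size_poly_leq0 => /eqP.
  by rewrite !mul0r !homogenize0 expr0; ring.
have {}sp : (size p <= d.+1)%N.
  by case: eqP sp => [->|//]; rewrite size_poly0.
rewrite mulrAC addSn !homogenizeMX IHp //; ring.
Qed.

Lemma homogenize_geom t z d p : (size p <= d.+1)%N ->
  homogenize t (z * t) d p = p.[z] * t ^+ d.
Proof.
move=> sp; rewrite (horner_coef_wide z sp) mulr_suml /homogenize.
apply: eq_bigr => i _.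
have -> : t ^+ d = t ^+ (d - i) * t ^+ i by rewrite -exprD subnK // leq_ord.
rewrite exprMn; ring.
Qed.

End Homogenize.

Lemma rmorph_homogenize (A B : comNzRingType) (f : {rmorphism A -> B})
    (s t : A) d (p : {poly A}) :
  f (homogenize s t d p) = homogenize (f s) (f t) d (map_poly f p).
Proof.
rewrite /homogenize rmorph_sum; apply: eq_bigr => i _.
by rewrite !rmorphM !rmorphXn coef_map.
Qed.

(** * Ideals with three generators and the tridiagonal system *)

Section Ideal3.
Context {A : comNzRingType}.
Implicit Types u v w a b : A.

(** Serves for [(x^n, y^n, F)], the preimage in [S] of the ideal of [R], and for [(x, y, hom Q)]. *)
Definition ideal3 u v w a := exists c d e, a = c * u + d * v + e * w.

Lemma ideal3D u v w a b : ideal3 u v w a -> ideal3 u v w b -> ideal3 u v w (a + b).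
Proof.
move=> [c [d [e ->]]] [c' [d' [e' ->]]].
by exists (c + c'), (d + d'), (e + e'); ring.
Qed.

Lemma ideal3M u v w a b : ideal3 u v w b -> ideal3 u v w (a * b).
Proof.
by move=> [c [d [e ->]]]; exists (a * c), (a * d), (a * e); ring.
Qed.

Lemma ideal3_sum u v w n (f : 'I_n -> A) :
  (forall i, ideal3 u v w (f i)) -> ideal3 u v w (\sum_i f i).
Proof.
move=> h; elim/big_ind: _ => // [|a b]; first by exists 0, 0, 0; ring.
exact: ideal3D.
Qed.

End Ideal3.

Definition geom (A : nzRingType) (n : nat) : {poly A} := \sum_(i < n) 'X^i.

Lemma size_geom (A : nzRingType) n : size (geom A n) = n.
Proof.
rewrite /geom (_ : \sum_(i < n) _ = \poly_(i < n) (1 : A)).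
  by case: n => [|n]; [apply/eqP; rewrite -leqn0 size_poly | rewrite size_poly_eq ?oner_neq0].
by rewrite poly_def; apply: eq_bigr => i _; rewrite scale1r.
Qed.

(* Modulo the ideal, the monomials [e_i = x^i y^(j+m+3-i)] satisfy
   [s (e_(i+1) - e_i) = t (e_i - e_(i-1))]; the two conclusions are the
   solution of this recursion starting from [e_1 = 0]. *)
Lemma tridiagonal_recursion (A : comNzRingType) (x y s t : A) (j m : nat) :
  let J := ideal3 (x ^+ (j + m).+2) (y ^+ (j + m).+2)
                  (x * y * (x - y) * (s * x - t * y)) in
  let e2 := x ^+ 2 * y ^+ (j + m).+1 in
  J (homogenize s t j (geom A j.+1) * e2 - s ^+ j * (x ^+ j.+2 * y ^+ m.+1)) /\
  J (s ^+ j * (x ^+ j.+2 * y ^+ m.+1 - x ^+ j.+1 * y ^+ m.+2) - t ^+ j * e2).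
Proof.
elim: j m => [|j IHj] m /=.
  rewrite !add0n; split.
    rewrite /homogenize big_ord1 /geom big_ord1 coefXn /=.
    by exists 0, 0, 0; ring.
  by exists 0, (- x), 0; rewrite !exprS; ring.
(* Raising [j] lowers [m], so [j + m], the ideal and [e2] stay fixed. *)
have := IHj m.+1; rewrite /= addnS addSn => -[IHk IHl].
set J := ideal3 _ _ _ in IHk IHl *.
set e2 := x ^+ 2 * _ in IHk IHl *.
have Jl : J (s ^+ j.+1 * (x ^+ j.+3 * y ^+ m.+1 - x ^+ j.+2 * y ^+ m.+2)
             - t ^+ j.+1 * e2).
  (* The multiple [x^j y^m F] relates three consecutive monomials. *)
  have -> : s ^+ j.+1 * (x ^+ j.+3 * y ^+ m.+1 - x ^+ j.+2 * y ^+ m.+2)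
              - t ^+ j.+1 * e2
    = s ^+ j * x ^+ j * y ^+ m * (x * y * (x - y) * (s * x - t * y))
      + t * (s ^+ j * (x ^+ j.+2 * y ^+ m.+2 - x ^+ j.+1 * y ^+ m.+3)
             - t ^+ j * e2).
    by rewrite !exprS; ring.
  apply: ideal3D; last exact: ideal3M.
  by exists 0, 0, (s ^+ j * x ^+ j * y ^+ m); ring.
split=> //.
have -> : homogenize s t j.+1 (geom A j.+2)
        = s * homogenize s t j (geom A j.+1) + t ^+ j.+1.
  have -> : geom A j.+2 = geom A j.+1 + 'X^(j.+1) by rewrite /geom big_ord_recr.
  rewrite homogenizeD homogenizeXn // subnn mul1r -{1}[j.+1]addn1.
  by rewrite homogenize_widen ?size_geom // expr1.
set h := homogenize _ _ _ _ in IHk *.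
have -> : (s * h + t ^+ j.+1) * e2 - s ^+ j.+1 * (x ^+ j.+3 * y ^+ m.+1)
  = s * (h * e2 - s ^+ j * (x ^+ j.+2 * y ^+ m.+2))
    + (-1) * (s ^+ j.+1 * (x ^+ j.+3 * y ^+ m.+1 - x ^+ j.+2 * y ^+ m.+2)
             - t ^+ j.+1 * e2).
  by rewrite !exprS; ring.
by apply: ideal3D; apply: ideal3M.
Qed.

(** At [m = 0] the recursion ends in a multiple of [x^(N+2)], which lies in the ideal. *)
Lemma homogenize_geom_mem (A : comNzRingType) (x y s t : A) (N : nat) :
  ideal3 (x ^+ N.+2) (y ^+ N.+2) (x * y * (x - y) * (s * x - t * y))
    (homogenize s t N (geom A N.+1) * (x ^+ 2 * y ^+ N.+1)).
Proof.
have [] := tridiagonal_recursion A x y s t N 0; rewrite addn0 => h _.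
rewrite -[X in ideal3 _ _ _ X](subrK (s ^+ N * (x ^+ N.+2 * y ^+ 1))).
by apply: ideal3D h _; exists (s ^+ N * y), 0, 0; ring.
Qed.

(** * Polynomials in four variables modulo [x] and [y] *)

Lemma mpoly_gen_ind (n : nat) (K : comNzRingType) (P : {mpoly K[n]} -> Prop) :
  (forall c, P (mpolyC n c)) -> (forall p q, P p -> P q -> P (p + q)) ->
  (forall i p, P p -> P ('X_i * p)) -> forall p, P p.
Proof.
move=> PC PD PX; elim/mpolyind => [|c m p _ _ Pp]; first by rewrite -mpolyC0.
apply: (PD) Pp; rewrite -mul_mpolyC mpolyXE_id mulrC.
elim/big_rec: _ => [|i q _]; first by rewrite mul1r.
by rewrite -mulrA; elim: (m i) => [|e IHe] Pq; rewrite ?mul1r // exprS -mulrA; apply/PX/IHe.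
Qed.

Lemma mmap_gen_eq (n : nat) (K B : comNzRingType) (f g : {rmorphism {mpoly K[n]} -> B}) :
  (forall c, f (mpolyC n c) = g (mpolyC n c)) -> (forall i, f 'X_i = g 'X_i) -> f =1 g.
Proof.
move=> hC hX; elim/mpoly_gen_ind => // [p q hp hq|i p hp].
  by rewrite !rmorphD /= hp hq.
by rewrite !rmorphM /= hp hX.
Qed.

Section Decomposition.
Context {k : fieldType}.
Implicit Types p q : {poly k}.
Notation S := {mpoly k[4]}.
Notation x := (varx k).
Notation y := (vary k).
Notation s := (vars k).
Notation t := (vart k).

Definition hform (d : nat) (p : {poly k}) : S :=
  homogenize s t d (map_poly (@mpolyC 4 k) p).

Lemma hformD d p q : hform d (p + q) = hform d p + hform d q.
Proof. by rewrite /hform rmorphD homogenizeD. Qed.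

Lemma hform0 d : hform d 0 = 0.
Proof. by rewrite /hform rmorph0 homogenize0. Qed.

Lemma hformM d e p q : (size p <= d.+1)%N -> (size q <= e.+1)%N ->
  hform (d + e) (p * q) = hform d p * hform e q.
Proof.
move=> sp sq; rewrite /hform rmorphM homogenizeM //; exact: leq_trans (size_poly _ _) _.
Qed.

Lemma hformS d p : (size p <= d.+1)%N -> hform d.+1 p = s * hform d p.
Proof.
move=> sp; rewrite /hform -[d.+1]addn1 homogenize_widen ?expr1 //.
exact: leq_trans (size_poly _ _) _.
Qed.

Lemma hformMX d p : hform d.+1 (p * 'X) = t * hform d p.
Proof. by rewrite /hform rmorphM /= map_polyX homogenizeMX. Qed.

Lemma hform_geom_mem N :
  ideal3 (x ^+ N.+2) (y ^+ N.+2) (polyF k)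
    (hform N (geom k N.+1) * (x ^+ 2 * y ^+ N.+1)).
Proof.
have -> : hform N (geom k N.+1) = homogenize s t N (geom S N.+1).
  congr homogenize; rewrite /geom rmorph_sum; apply: eq_bigr => i _.
  exact: map_polyXn.
exact: homogenize_geom_mem.
Qed.

(** Modulo [x] and [y], [f] is a sum of forms in [s, t], recorded by their dehomogenizations [A d].
    Allowing every large [B] lets two decompositions be added. *)
Lemma mpoly4_decomposition (f : S) :
  exists (A : nat -> {poly k}) (f1 f2 : S) (B0 : nat),
    (forall d, (size (A d) <= d.+1)%N) /\
    (forall B, (B0 <= B)%N ->
       f = \sum_(d < B) hform d (A d) + x * f1 + y * f2).
Proof.
elim/mpoly_gen_ind: f => [c
  |p q [A [f1 [f2 [B0 [sA fE]]]]] [A' [f1' [f2' [B0' [sA' fE']]]]]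
  |i p [A [f1 [f2 [B0 [sA fE]]]]]].
- exists (fun d => if d == 0 then c%:P else 0), 0, 0, 1; split=> [[|d]|[|B] // _].
  + by rewrite size_polyC; case: eqP.
  + by rewrite size_poly0.
  rewrite big_ord_recl big1 => [|j _]; last by rewrite hform0.
  by rewrite /hform /homogenize big_ord1 map_polyC coefC /= !expr0; ring.
- exists (fun d => A d + A' d), (f1 + f1'), (f2 + f2'), (maxn B0 B0'); split=> [d|B].
    by rewrite (leq_trans (size_polyD _ _)) // geq_max sA sA'.
  rewrite geq_max => /andP[leB leB'].
  rewrite [in LHS](fE _ leB) [in LHS](fE' _ leB').
  under [in RHS]eq_bigr => d _ do rewrite hformD.
  by rewrite big_split /=; ring.
have := fE _ (leqnn B0); set f0 := \sum_(_ < B0) _ => pE.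
(* A factor [x] or [y] moves everything into [f1] or [f2]. A factor [s] or [t] shifts the degrees by
   one, and [t] also multiplies [A d] by ['X]. *)
have [|] := eqVneq (i : nat) 0%N => [i0|i0].
  exists (fun=> 0), p, 0, 0%N; split=> [d|B _]; first by rewrite size_poly0.
  rewrite big1 => [|d _]; last exact: hform0.
  have -> : 'X_i = x by rewrite /varx; congr 'X_ _; apply: val_inj; rewrite /= inordK.
  by ring.
have [|] := eqVneq (i : nat) 1%N => [i1|i1].
  exists (fun=> 0), 0, p, 0%N; split=> [d|B _]; first by rewrite size_poly0.
  rewrite big1 => [|d _]; last exact: hform0.
  have -> : 'X_i = y by rewrite /vary; congr 'X_ _; apply: val_inj; rewrite /= inordK.
  by ring.
have [|] := eqVneq (i : nat) 2%N => [i2|i2].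
  exists (fun d => if d is d'.+1 then A d' else 0), ('X_i * f1), ('X_i * f2), B0.+1.
  split=> [[|d]|[|B] //]; first by rewrite size_poly0.
    exact: leqW.
  rewrite ltnS => leB; rewrite [in LHS](fE _ leB) big_ord_recl hform0.
  have -> : 'X_i = s by rewrite /vars; congr 'X_ _; apply: val_inj; rewrite /= inordK.
  under [in RHS]eq_bigr => d _ do rewrite /= /bump /= add1n hformS //.
  by rewrite -mulr_sumr; ring.
exists (fun d => if d is d'.+1 then A d' * 'X else 0), ('X_i * f1), ('X_i * f2), B0.+1.
split=> [[|d]|[|B] //]; first by rewrite size_poly0.
  have [->|nz] := eqVneq (A d) 0; first by rewrite mul0r size_poly0.
  by rewrite size_mulX // ltnS.
rewrite ltnS => leB; rewrite [in LHS](fE _ leB) big_ord_recl hform0.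
have -> : 'X_i = t.
  rewrite /vart; congr 'X_ _; apply: val_inj; rewrite /= inordK //.
  by case: i i0 i1 i2 => [[|[|[|[|]]]]].
under [in RHS]eq_bigr => d _ do rewrite /= /bump /= add1n hformMX.
by rewrite -mulr_sumr; ring.
Qed.

End Decomposition.

(** * Evaluation at a root and on lines through the origin *)

(** If [Q] does not divide [p], the two are coprime, also over [L], and share no root. *)
Lemma irredp_root_dvdp (K L : fieldType) (iota : {rmorphism K -> L}) (Q p : {poly K}) (z : L) :
  irreducible_poly Q -> root (map_poly iota Q) z ->
  root (map_poly iota p) z = (Q %| p).
Proof.
move=> irrQ rQ; apply/idP/idP => [rp|/dvdpP[c ->]]; last first.
  by rewrite rmorphM rootM rQ orbT.
apply: contraLR rp; rewrite -(irreducible_poly_coprime p irrQ) -(coprimep_map iota) => cop.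
exact: coprimep_root cop rQ.
Qed.

Section Evaluation.
Context {k L : fieldType} (iota : {rmorphism k -> L}) (z : L).
Notation S := {mpoly k[4]}.
Notation x := (varx k).
Notation y := (vary k).
Notation s := (vars k).
Notation t := (vart k).
Implicit Types (u v : L) (f : S) (p : {poly k}).

(** Restriction to [x = y = 0], [t = z s]. For [z] a root of an irreducible [Q] the kernel is
    [(x, y, hom Q)], a prime since [{poly L}] is a domain. *)
Definition base_eval : S -> {poly L} :=
  mmap (polyC \o iota) (tnth [tuple 0; 0; 'X; z%:P * 'X]).

HB.instance Definition _ := GRing.RMorphism.on base_eval.

(** The outer variable [Y] runs along the line of direction [(u, v)] in the [(x, y)]-plane; the
    inner one is the value of [s], and [t = z s]. *)
Definition line_eval u v : S -> {poly {poly L}} :=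
  mmap (polyC \o (polyC \o iota))
       (tnth [tuple u%:P%:P * 'X; v%:P%:P * 'X; ('X)%:P; (z%:P * 'X)%:P]).

HB.instance Definition _ u v := GRing.RMorphism.on (line_eval u v).

Lemma base_eval_vars :
  (base_eval x = 0) * (base_eval y = 0) * (base_eval s = 'X) * (base_eval t = z%:P * 'X).
Proof.
by rewrite /base_eval /varx /vary /vars /vart !mmapX !mmap1U /tnth /= !inordK.
Qed.

Lemma line_eval_vars u v :
  (line_eval u v x = u%:P%:P * 'X) * (line_eval u v y = v%:P%:P * 'X) *
  (line_eval u v s = ('X)%:P) * (line_eval u v t = (z%:P * 'X)%:P).
Proof.
by rewrite /line_eval /varx /vary /vars /vart !mmapX !mmap1U /tnth /= !inordK.
Qed.

Lemma base_eval_hform d p : (size p <= d.+1)%N ->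
  base_eval (hform d p) = (map_poly iota p).[z] *: 'X^d.
Proof.
move=> sp; rewrite /hform rmorph_homogenize /= !base_eval_vars homogenize_geom; last first.
  by rewrite (leq_trans (size_poly _ _)) ?(leq_trans (size_poly _ _)).

rewrite -mul_polyC -map_poly_comp.
rewrite (eq_map_poly (_ : _ =1 (polyC \o iota))); last by move=> c /=; exact: mmapC.
by rewrite map_poly_comp horner_map.
Qed.

Lemma line_eval_hform u v d p :
  line_eval u v (hform d p) = (base_eval (hform d p))%:P.
Proof.
rewrite /hform !rmorph_homogenize /= !base_eval_vars !line_eval_vars.
rewrite -!map_poly_comp. congr homogenize; apply: eq_map_poly => c /=.
by rewrite /line_eval /base_eval !mmapC.
Qed.

Lemma line_eval_coef0 u v f : (line_eval u v f)`_0 = base_eval f.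
Proof.
rewrite -horner_coef0 -[LHS]/((horner_eval 0 \o line_eval u v) f).
apply: mmap_gen_eq => [c|i] /=.
  by rewrite /line_eval /base_eval !mmapC /= /horner_eval hornerC.
rewrite /line_eval /base_eval !mmapX !mmap1U /horner_eval /tnth.
by case: i => [[|[|[|[|]]]]] //= _; rewrite ?hornerE.
Qed.

(** Only [x * f1 + y * f2] contributes, with [f1] and [f2] taken at [Y = 0]. As [a] and [b] do not
    depend on the line, different lines can be compared. *)
Lemma line_eval_coef1 f : exists a b : {poly L},
  forall u v, (line_eval u v f)`_1 = u *: a + v *: b.
Proof.
have [A [f1 [f2 [B [sA /(_ B (leqnn B)) fE]]]]] := mpoly4_decomposition f.
exists (base_eval f1), (base_eval f2) => u v; rewrite {1}fE !rmorphD !rmorphM /=.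
rewrite !line_eval_vars rmorph_sum /= !coefD coef_sum big1 => [|d _]; last first.
  by rewrite line_eval_hform // coefC.
by rewrite -!mulrA !coefCM !coefXM /= !line_eval_coef0 !mul_polyC add0r.
Qed.

(** The forms of different degrees go to different powers of ['X], so each [A d] vanishes at [z] and
    is divisible by [Q]. *)
Lemma base_eval_kernel (Q : {poly k}) f :
  irreducible_poly Q -> root (map_poly iota Q) z -> base_eval f = 0 ->
  ideal3 x y (hform (size Q).-1 Q) f.
Proof.
move=> irrQ rQ; have [A [f1 [f2 [B [sA /(_ B (leqnn B)) ->]]]]] := mpoly4_decomposition f.
rewrite !rmorphD !rmorphM rmorph_sum /= !base_eval_vars !mul0r !addr0 => f0.
apply: ideal3D; last by exists 0, f2, 0; ring.
apply: ideal3D; last by exists f1, 0, 0; ring.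
apply: ideal3_sum => d.
have rA : (map_poly iota (A d)).[z] = 0.
  move/(congr1 (fun P : {poly L} => P`_d)): f0.
  rewrite coef0 coef_sum (bigD1 d) //= base_eval_hform // coefZ coefXn eqxx mulr1.
  rewrite big1 ?addr0 // => e ne; rewrite base_eval_hform // coefZ coefXn.
  by rewrite eq_sym (inj_eq val_inj) (negPf ne) mulr0.
have dQ : Q %| A d by rewrite -(irredp_root_dvdp _ _ iota _ _ _ irrQ rQ); apply/rootP.
have [->|nzA] := eqVneq (A d : {poly k}) 0; first by rewrite hform0; exists 0, 0, 0; ring.
have sQ : (0 < size Q)%N by rewrite size_poly_gt0 irredp_neq0.
have sQd := dvdp_leq nzA dQ.
have := sA d; set c := A d %/ Q => sAd.
have sc : size c = (size (A d) - (size Q).-1)%N by rewrite size_divp // irredp_neq0.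
rewrite -(divpK dQ) -/c; exists 0, 0, (hform (d - (size Q).-1) c).
have led : ((size Q).-1 <= d)%N.
  by rewrite -ltnS prednK // (leq_trans sQd).
rewrite -[X in hform X _](subnK led) hformM ?prednK //; first by ring.
by rewrite sc -subSn // leq_sub2r.
Qed.

End Evaluation.

(** * The annihilator of the witness *)

Lemma geom_mul (A : nzRingType) n : 'X^n - 1 = ('X - 1) * geom A n.
Proof. exact: subrX1. Qed.

Lemma separable_geom (K : fieldType) n : n%:R != 0 :> K -> separable_poly (geom K n).
Proof.
move=> nz; apply: dvdp_separable (separable_Xn_sub_1 nz).
by rewrite geom_mul dvdp_mull.
Qed.

Lemma rmorph_relation {A B : comNzRingType} (f : {rmorphism A -> B})
    (a s h x y c d g F : A) m n :
  f F = 0 -> a * (s * h * (x ^+ 2 * y ^+ m)) = c * x ^+ n + d * y ^+ n + g * F ->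
  f a * (f s * f h * (f x ^+ 2 * f y ^+ m)) = f c * f x ^+ n + f d * f y ^+ n.
Proof.
move=> F0 /(congr1 f).
by rewrite !rmorphD !rmorphM /= F0 mulr0 addr0 !rmorphXn.
Qed.

Section Annihilator.
Context {k L : fieldType} (iota : {rmorphism k -> L}) (z : L).
Notation S := {mpoly k[4]}.
Notation x := (varx k).
Notation y := (vary k).
Notation s := (vars k).
Notation t := (vart k).
Context {N : nat} {Q H' : {poly k}}.
Hypotheses (nz : N.+1%:R != 0 :> k) (irrQ : irreducible_poly Q).
Hypotheses (QH : Q * H' = geom k N.+1) (rQ : root (map_poly iota Q) z).

(** [H'] is [H/Q]. The factor [s] is there for [x]: [F] expresses [s x^3 y], not [x^3 y], by lower
    powers of [x]. *)
Definition witness : S :=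
  s * hform (N - (size Q).-1) H' * (x ^+ 2 * y ^+ N.+1).

Let J := ideal3 (x ^+ N.+2) (y ^+ N.+2) (polyF k).

Let QH_neq0 : Q * H' != 0.
Proof. by rewrite QH -size_poly_eq0 size_geom. Qed.

Let Q_neq0 : Q != 0. Proof. by apply: contraNneq QH_neq0 => ->; rewrite mul0r. Qed.
Let H'_neq0 : H' != 0. Proof. by apply: contraNneq QH_neq0 => ->; rewrite mulr0. Qed.

Let sizeQH : ((size Q).-1 + (size H').-1 = N)%N.
Proof.
have := size_mul Q_neq0 H'_neq0; rewrite QH size_geom.
move: Q_neq0 H'_neq0; rewrite -!size_poly_gt0; case: (size Q) => // a.
case: (size H') => // b _ _; rewrite addnS addSn => -[->].
by [].
Qed.

Let sizeH' : size H' = (N - (size Q).-1).+1.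
Proof. by rewrite -{1}sizeQH addKn prednK // size_poly_gt0. Qed.

Lemma witness_annihilated (a : S) : base_eval iota z a = 0 -> J (a * witness).
Proof.
move=> /(base_eval_kernel _ _ _ _ irrQ rQ) [c [d [e ->]]].
set h := hform (N - (size Q).-1) H'; rewrite /witness -/h.
have -> : (c * x + d * y + e * hform (size Q).-1 Q) * (s * h * (x ^+ 2 * y ^+ N.+1))
  = (c * h) * (s * x ^+ 3 * y ^+ N.+1) + (d * s * h * x ^+ 2 * y ^+ N.+2
    + (e * s) * (hform (size Q).-1 Q * h * (x ^+ 2 * y ^+ N.+1))).
  by rewrite !exprS; ring.
apply: ideal3D; [apply: ideal3M|apply: ideal3D; [|apply: ideal3M]].
(* This is [s x^3 y^(N+1) = y^N F + ((s+t) x^2 - t x y) y^(N+2)]. *)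
- exists 0, ((s + t) * x ^+ 2 - t * x * y), (y ^+ N).
  by rewrite /polyF !exprS; ring.
- by exists 0, (d * s * h * x ^+ 2), 0; ring.
rewrite /h -hformM ?sizeH' ?leqSpred //.
have leqN : ((size Q).-1 <= N)%N by rewrite -sizeQH leq_addr.
by rewrite QH subnKC //; exact: hform_geom_mem.
Qed.

Let geom_root : (map_poly iota (geom k N.+1)).[z] = 0.
Proof. by rewrite -QH rmorphM hornerM (rootP rQ) mul0r. Qed.

Let map_geom : map_poly iota (geom k N.+1) = geom L N.+1.
Proof. by rewrite /geom rmorph_sum; apply: eq_bigr => i _; exact: map_polyXn. Qed.

Let z_unity : z ^+ N.+1 = 1.
Proof.
apply/eqP; rewrite -subr_eq0.
have -> : z ^+ N.+1 - 1 = ('X^(N.+1) - 1).[z] by rewrite !hornerE.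
by rewrite geom_mul hornerM -map_geom geom_root mulr0.
Qed.

Let z_neq0 : z != 0.
Proof. by apply: contra_eq_neq z_unity => ->; rewrite expr0n eq_sym oner_eq0. Qed.

(** [H] takes the value [N + 1] at 1. *)
Let z_neq1 : z != 1.
Proof.
apply: contraNneq nz => z1; rewrite -(fmorph_eq0 iota) rmorph_nat; apply/eqP.
rewrite -geom_root map_geom z1 /geom horner_sum.
under eq_bigr => i _ do rewrite hornerXn expr1n.
by rewrite sumr_const card_ord.
Qed.

(** Otherwise [Q] divides [H/Q], so its square divides the separable [H]. *)
Let H'_root : (map_poly iota H').[z] != 0.
Proof.
rewrite -rootE (irredp_root_dvdp _ _ iota _ _ _ irrQ rQ); apply/negP => dQ.
have sQ : size Q != 1%N by case: irrQ => sQ _; rewrite gtn_eqF.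
have := separable_nosquare (separable_geom _ _ nz) (isT : (1 < 2)%N) sQ.
by rewrite -QH expr2 dvdp_mul.
Qed.

(* The coefficient of [Y^(N+3)] of the equation, restricted to the line
   [(uY, vY)]; [F] vanishes identically on the four lines of its factorization. *)
Let coef_on_line (a c d g : S) :
  a * witness = c * x ^+ N.+2 + d * y ^+ N.+2 + g * polyF k ->
  forall u v, u * v * (u - v) * (u - z * v) = 0 ->
  (u ^+ 2 * v ^+ N.+1) *: (base_eval iota z (a * s * hform (N - (size Q).-1) H')) =
  u ^+ N.+2 *: (line_eval iota z u v c)`_1 + v ^+ N.+2 *: (line_eval iota z u v d)`_1.
Proof.
move=> eqa u v uv0; set h := hform _ _ in eqa *.
have F0 : line_eval iota z u v (polyF k) = 0.
  rewrite /polyF !(rmorphM, rmorphB) /= !line_eval_vars.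
  rewrite (_ : _ * _ = (u * v * (u - v) * (u - z * v))%:P%:P * 'X%:P * 'X^4).
    by rewrite uv0 !mul0r.
  by rewrite !(rmorphM, rmorphB) /=; ring.
have eql : line_eval iota z u v a * (line_eval iota z u v s * line_eval iota z u v h *
      (line_eval iota z u v x ^+ 2 * line_eval iota z u v y ^+ N.+1)) =
    line_eval iota z u v c * line_eval iota z u v x ^+ N.+2 +
    line_eval iota z u v d * line_eval iota z u v y ^+ N.+2.
  exact: rmorph_relation F0 eqa.
rewrite !line_eval_vars line_eval_hform in eql.
have {}eql : line_eval iota z u v a * (u ^+ 2)%:P%:P * (v ^+ N.+1)%:P%:P
               * ('X * base_eval iota z h)%:P * 'X^(N.+3)
  = line_eval iota z u v c * (u ^+ N.+2)%:P%:P * 'X^(N.+2)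
    + line_eval iota z u v d * (v ^+ N.+2)%:P%:P * 'X^(N.+2).
  move: eql; rewrite [('X * _)%:P]polyCM !polyC_exp => eql.
  transitivity (line_eval iota z u v a *
    (('X)%:P * (base_eval iota z h)%:P * ((u%:P%:P * 'X) ^+ 2 * (v%:P%:P * 'X) ^+ N.+1))).
    by rewrite !exprMn !exprS; ring.
  by rewrite eql !exprMn; ring.
(* On the left [Y^(N+3)] leaves the constant coefficient of [a], on the right [Y^(N+2)] leaves the
   linear coefficients of [c] and [d]. *)
have := congr1 (fun f : {poly {poly L}} => f`_N.+3) eql.
rewrite coefD !coefMXn !ltnn subnn ltnNge leqnSn /= subSnn !coefMC line_eval_coef0.
have -> : base_eval iota z (a * s * h) = base_eval iota z a * 'X * base_eval iota z h.
  by rewrite !rmorphM /= base_eval_vars.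
rewrite -!mul_polyC ![_%:P * _`_1]mulrC => <-; rewrite [(_ * _ ^+ _)%:P]polyCM; ring.
Qed.

(** The directions [(1,0)] and [(0,1)] kill [a1] and [b2]; [(1,1)] and [(z,1)] then give two
    equations for [al] and [b1 + a2]. *)
Lemma annihilatorP (a : S) : J (a * witness) <-> base_eval iota z a = 0.
Proof.
split=> [[c [d [g eqa]]]|]; last exact: witness_annihilated.
have [a1 [b1 lc]] := line_eval_coef1 iota z c.
have [a2 [b2 ld]] := line_eval_coef1 iota z d.
have E := coef_on_line _ _ _ _ eqa.
set al := base_eval iota z _ in E.
have a10 : a1 = 0.
  have /E : (1 : L) * 0 * (1 - 0) * (1 - z * 0) = 0 by ring.
  by rewrite lc ld !expr0n !expr1n /= mulr0 !scale0r !scale1r !addr0.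
have b20 : b2 = 0.
  have /E : (0 : L) * 1 * (0 - 1) * (0 - z * 1) = 0 by ring.
  by rewrite lc ld !expr0n !expr1n /= mul0r !scale0r !scale1r !add0r.
have al1 : al = b1 + a2.
  have /E : (1 : L) * 1 * (1 - 1) * (1 - z * 1) = 0 by ring.
  by rewrite lc ld !expr1n mulr1 !scale1r a10 b20 add0r addr0.
(* Since [z^(N+2) = z], the direction [(z, 1)] gives [z^2 al = z (b1 + a2) = z al]. *)
have : (z * (z - 1)) *: al = 0.
  rewrite mulrBr mulr1 -expr2.
  have /E : z * 1 * (z - 1) * (z - z * 1) = 0 by ring.
  rewrite lc ld !expr1n mulr1 !scale1r a10 b20 scaler0 add0r addr0.
  rewrite (exprSr z N.+1) z_unity mul1r scalerBl => ->.
  by rewrite al1 scalerDr subrr.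
move/eqP; rewrite scaler_eq0 mulf_eq0 subr_eq0.
(* Now [al = 0] is a product in a domain whose factors from [s] and [H'] are nonzero. *)
rewrite (negPf z_neq1) (negPf z_neq0) /= /al !rmorphM /= base_eval_vars !mulf_eq0 polyX_eq0 orbF.
rewrite base_eval_hform ?sizeH' // scaler_eq0 (negPf H'_root)
  (negPf (monic_neq0 (monicXn _ _))) /= !orbF.
by move/eqP.
Qed.

End Annihilator.

(** * Choice of the irreducible factor and of the exponent *)

Lemma exists_irredp_dvd (K : fieldType) (p : {poly K}) :
  (1 < size p)%N -> exists2 Q, irreducible_poly Q & Q %| p.
Proof.
move: {2}(size p) (leqnn (size p)) => n; elim: n p => [|n IHn] p; first by move=> s0 /leq_trans/(_ s0).
move=> spn sp; have [irr|] := classic (irreducible_poly p); first by exists p.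
move=> nirr; have [q] : exists q : {poly K}, ~ (size q != 1%N -> q %| p -> q %= p).
  by apply: not_all_ex_not => h; apply: nirr.
move=> nq; have [sq {}nq] := imply_to_and _ _ nq; have [qp neq] := imply_to_and _ _ nq.
have nzp : p != 0 by rewrite -size_poly_gt0 ltnW.
have nzq : q != 0 by apply: contraTneq qp => ->; rewrite dvd0p.
have ltq : (size q < size p)%N.
  rewrite ltn_neqAle dvdp_leq // andbT; apply/negP => /eqP eqs.
  by apply: neq; rewrite -dvdp_size_eqp // eqs.
have [||Q irrQ dQ] := IHn q.
- by rewrite -ltnS (leq_trans ltq).
- by rewrite ltn_neqAle eq_sym sq size_poly_gt0.
by exists Q => //; exact: dvdp_trans dQ qp.
Qed.

(** Take [Q] dividing [H / gcd(H, G)], which is not constant by the degrees. If [Q] divided [G], it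
    would divide the gcd, and its square would divide [H]. *)
Lemma exists_irredp_dvd_ndvd (K : fieldType) (H G : {poly K}) :
  separable_poly H -> G != 0 -> (size G < size H)%N ->
  exists Q, [/\ irreducible_poly Q, Q %| H & ~~ (Q %| G)].
Proof.
move=> sepH nzG ltGH; set d := gcdp H G.
have dH : d %| H by exact: dvdp_gcdl.
have nzH := separable_poly_neq0 sepH.
have Hdec := divpK dH.
have nzc : H %/ d != 0 by apply: contraNneq nzH => c0; rewrite -Hdec c0 mul0r.
have sc : (1 < size (H %/ d)%R)%N.
  rewrite ltn_neqAle size_poly_gt0 nzc andbT; apply/negP; rewrite eq_sym => sc1.
  have : (H %| G)%R.
    apply: dvdp_trans (dvdp_gcdr _ _ : (d %| G)%R); rewrite -/d -{1}Hdec.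
    by move/size_poly1P: sc1 => [e nze ->]; rewrite mul_polyC dvdpZl.
  by move/(dvdp_leq nzG); rewrite leqNgt ltGH.
have [Q irrQ dQ] := exists_irredp_dvd _ _ sc.
have QH : Q %| H by rewrite -Hdec dvdp_mulr.
exists Q; split=> //; apply/negP => QG.
have sQ : size Q != 1%N by case: irrQ => sQ _; rewrite gtn_eqF.
have := separable_nosquare sepH (isT : (1 < 2)%N) sQ.
by rewrite -Hdec expr2 dvdp_mul // dvdp_gcd QH.
Qed.

(** [G] is the product of one polynomial chosen for each [P] of the list that has any. *)
Lemma exists_poly_meeting (K : fieldType) (T : Type) (C : T -> {poly K} -> Prop) (l : seq T) :
  exists2 G : {poly K}, G != 0 &
    forall P, Stdlib.Lists.List.In P l -> forall p, p != 0 -> C P p ->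
    exists p', [/\ p' != 0, p' %| G & C P p'].
Proof.
elim: l => [|P l [G nzG IHl]]; first by exists 1; rewrite ?oner_neq0.
have [[p [nzp Cp]]|none] := classic (exists p, p != 0 /\ C P p).
  exists (p * G); first by rewrite mulf_neq0.
  move=> P' /= [<-|inl] q nzq Cq; first by exists p; rewrite dvdp_mulr.
  by have [p' [? ? ?]] := IHl P' inl q nzq Cq; exists p'; rewrite dvdp_mull.
exists G => // P' /= [<-|inl] q nzq Cq; last exact: IHl inl q nzq Cq.
by case: none; exists q.
Qed.

(** In characteristic [p] take [n = p^e], so that [n - 1] is [-1] in [K]. *)
Lemma large_good_exponent (K : fieldType) (Sset : nat -> Prop) :
  (forall m, exists n, (m <= n)%N /\ Sset n) ->
  [pchar K] =i pred0 \/ (exists p, p \in [pchar K] /\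
    (forall m, exists e, (m <= e)%N /\ Sset (p ^ e)%N)) ->
  forall m, exists2 N, (m <= N)%N & Sset N.+2 /\ N.+1%:R != 0 :> K.
Proof.
move=> Sinf [ch0|[p [chp Sp]]] m.
  have [n [mn Sn]] := Sinf m.+2; exists n.-2; first by lia.
  have -> : n.-2.+2 = n by lia.
  by split=> //; move/pcharf0P: ch0 => ->.
have [e [me Se]] := Sp m.+2.
have p_gt1 : (1 < p)%N by apply: prime_gt1; case/andP: chp.
have lt_m := leq_ltn_trans me (ltn_expl e p_gt1).
have n0 : (p ^ e)%:R = 0 :> K.
  by rewrite natrX (pcharf0 chp) expr0n; case: e me {Se lt_m}.
exists (p ^ e).-2; first by lia.
have -> : (p ^ e).-2.+2 = (p ^ e)%N by lia.
split=> //; apply/eqP => n1; move: n0.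
have -> : (p ^ e = (p ^ e).-2.+1 + 1)%N by lia.
by rewrite natrD n1 add0r => /eqP; rewrite oner_eq0.
Qed.

(** * Infinitely many associated primes *)

Theorem theorem2p1 (k : fieldType) (R : comPzRingType)
  (pi : {rmorphism {mpoly k[4]} -> R})
  (pi_surj : forall r : R, exists f, pi f = r)
  (pi_ker : forall f, pi f = 0 <-> exists g, f = g * polyF k)
  (Sset : nat -> Prop)
  (Sset_pos : forall n, Sset n -> (0 < n)%N)
  (Sset_inf : forall m, exists n, (m <= n)%N /\ Sset n)
  (hchar : [pchar k] =i pred0 \/
           exists p, p \in [pchar k] /\
             (forall m, exists e, (m <= e)%N /\ Sset (p ^ e)%N)) :
  infinite_family (fun P : R -> Prop =>
    exists n, Sset n /\
      Ass_quot (ideal2 (pi (varx k) ^+ n) (pi (vary k) ^+ n)) P).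
Proof.
move=> l.
have [G nzG meetG] := exists_poly_meeting k _
  (fun P p => exists2 d, (size p <= d.+1)%N & P (pi (hform d p))) l.
have [N leGN [SN nzN]] := large_good_exponent _ _ Sset_inf hchar (size G).
have [||Q [irrQ QH nQG]] := exists_irredp_dvd_ndvd k (geom k N.+1) G _ nzG.
- exact: separable_geom.
- by rewrite size_geom ltnS.
have [L _ [z rQ _]] := irredp_FAdjoin irrQ.
have QH' : Q * (geom k N.+1 %/ Q) = geom k N.+1 by rewrite mulrC divpK.
have annP := annihilatorP _ _ nzN irrQ QH' rQ.
set w := witness in annP; set ev := base_eval _ z in annP.
have mem2 f : ideal2 (pi (varx k) ^+ N.+2) (pi (vary k) ^+ N.+2) (pi f) <->
              ideal3 (varx k ^+ N.+2) (vary k ^+ N.+2) (polyF k) f.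
  split=> [[c' [d' e]]|[c [d [g ->]]]]; last first.
    exists (pi c), (pi d); rewrite -!rmorphXn -!rmorphM -rmorphD [LHS]rmorphD.
    by rewrite (_ : pi (g * polyF k) = 0) ?addr0 //; apply/pi_ker; exists g.
  have [[c ec] [d ed]] := (pi_surj c', pi_surj d').
  have /pi_ker [g eg] : pi (f - (c * varx k ^+ N.+2 + d * vary k ^+ N.+2)) = 0.
    by rewrite rmorphB e -ec -ed -!rmorphXn -!rmorphM -rmorphD subrr.
  by exists c, d, g; rewrite -eg addrC subrK.
(* The annihilator of the class of [pi w]; its preimage in [S] is the kernel of [ev], which makes it
   prime. *)
pose P a := ideal2 (pi (varx k) ^+ N.+2) (pi (vary k) ^+ N.+2) (a * pi w).
have PE f : P (pi f) <-> ev f = 0.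
  by rewrite /P -rmorphM; apply: iff_trans (mem2 _) (annP f).
exists P; split.
  exists N.+2; split=> //; split; last by exists (pi w).
  split; first split.
  - by rewrite -(rmorph0 pi) PE /ev rmorph0.
  - move=> a b; have [[f <-] [g <-]] := (pi_surj a, pi_surj b).
    by rewrite -rmorphB !PE /ev rmorphB /= => -> ->; rewrite subrr.
  - move=> a b; have [[f <-] [g <-]] := (pi_surj a, pi_surj b).
    by rewrite -rmorphM !PE /ev rmorphM /= => ->; rewrite mulr0.
  - by rewrite -(rmorph1 pi) PE /ev rmorph1; apply/eqP; rewrite oner_eq0.
  - move=> a b; have [[f <-] [g <-]] := (pi_surj a, pi_surj b).
    rewrite -rmorphM !PE /ev rmorphM /= => /eqP; rewrite mulf_eq0.
    by case/orP => /eqP; [left|right].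
move=> P' inl eqP'.
have hform0E d (p : {poly k}) : (size p <= d.+1)%N -> P' (pi (hform d p)) <-> Q %| p.
  move=> sp; rewrite -eqP' PE /ev base_eval_hform //.
  rewrite -(irredp_root_dvdp _ _ _ _ _ _ irrQ rQ) rootE.
  split=> [/eqP|/eqP ->]; last by rewrite scale0r.
  by rewrite scaler_eq0 (negPf (monic_neq0 (monicXn _ _))) orbF.
(* [P'] contains a form of [Q], hence one of some [p] dividing [G]; then [Q] divides [p] and so [G],
   against its choice. *)
have [|p [nzp pG [d sp]]] := meetG P' inl Q (irredp_neq0 irrQ).
  by exists (size Q); rewrite ?leqnSn // hform0E ?leqnSn.
rewrite hform0E // => Qp.
by move/negP: nQG; apply; exact: dvdp_trans Qp pG.
Qed.
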